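(* Let $k$ be a positive integer and, for each $n\ge1$, let $\overline{w}_{n,k}$ denote the number of words $w_1\cdots w_n$ with all $w_i\in[n]$ that contain no weakly increasing subsequence of length $k+1$ (i.e. there are no indices $i_1<\dots<i_{k+1}$ with $w_{i_1}\le w_{i_2}\le\dots\le w_{i_{k+1}}$); equivalently, whose standardization avoids the permutation $12\cdots(k+1)$. Then the limit $\lim_{n\to\infty}\overline{w}_{n,k}^{1/n}$ exists and \[\limsup_{n\to\infty}\overline{w}_{n,k}^{1/n}=\frac{k^{k+1}}{(k-1)^{k-1}},\] with the convention $0^0=1$.
   Context: $[n]=\{1,\dots,n\}$. The standardization $\mathrm{std}(w)$ of a word $w=w_1\cdots w_n$ of positive integers is the permutation of $[n]$ obtained by replacing the letters of $w$ by $1,\dots,n$ preserving relative order, where equal letters are numbered increasingly from left to right. A permutation $\pi$ avoids $\sigma\in\mathfrak S_m$ if no subsequence of $\pi$ of length $m$ is order-isomorphic to $\sigma$. *)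

(* Defs.v *)
From HB Require Import structures.
From mathcomp Require Import all_boot all_order all_algebra.
From mathcomp Require Import all_classical all_reals all_analysis.
Set Implicit Arguments. Unset Strict Implicit. Unset Printing Implicit Defensive.

(* Words of length n over the alphabet [n], encoded as n.-tuple 'I_n
   (letter i+1 of [n] is represented by i : 'I_n; order is preserved). *)

Definition has_weak_incr_subseq (n m : nat) (w : n.-tuple 'I_n) : bool :=
  [exists msk : n.-tuple bool,
     (count id msk == m) &&
     sorted (fun a b : 'I_n => (a <= b)%N) (mask msk w)].

Definition wbar (n k : nat) : nat :=
  #|[set w : n.-tuple 'I_n | ~~ has_weak_incr_subseq k.+1 w]|.

(* Main.v *)
Require Import Defs.
From HB Require Import structures.
From mathcomp Require Import all_boot all_order all_algebra.
From mathcomp Require Import all_classical all_reals all_analysis.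
From mathcomp Require Import zify ring lra.
Import Order.TTheory GRing.Theory Num.Theory.
Import numFieldNormedType.Exports.
Set Implicit Arguments. Unset Strict Implicit. Unset Printing Implicit Defensive.

(* A word has no weakly increasing subsequence of length k+1 iff its positions
   can be coloured with k colours so that it strictly decreases on each colour
   class.  The number of pairs (colouring, word) is
     A_n = \sum_c \prod_j 'C(n, |c^-1(j)|),
   so w_n <= A_n, and 'C(n, a) (k-1)^(n-a) <= k^n bounds A_n by B^n, where B is
   the claimed limit.
   Conversely, cut positions and letters into blocks of length L and put the
   part of colour c of the b-th pair (out of N) into the letter block b + c.
   The two block numbers reveal the colour, so no information is lost:
   A_L^N <= w_n as soon as (N + k - 1) L <= n.  Finally A_L is at least B^L up
   to a polynomial factor: keep only the balanced colourings, and note that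
   'C(kq, q) (k-1)^((k-1)q) is the largest term in the binomial expansion of
   k^(kq).
   Letters are reversed below, so that classes are strictly increasing. *)

(** * Colourings, words increasing on each colour class, and their count *)

Definition ordlt (n : nat) : rel 'I_n := fun i j => i < j.

Lemma ordlt_trans n : transitive (@ordlt n).
Proof. by move=> j i l; apply: ltn_trans. Qed.

Lemma enum_set_sorted n (A : {set 'I_n}) : sorted (@ordlt n) (enum A).
Proof.
rewrite /enum_mem; apply: sorted_filter; first exact: ordlt_trans.
by have := iota_ltn_sorted 0 n; rewrite -val_enum_ord sorted_map enumT.
Qed.

Lemma pairwise_ordP n (r : rel 'I_n) (s : seq 'I_n) : sorted (@ordlt n) s ->
  reflect {in s &, forall i j : 'I_n, i < j -> r i j} (pairwise r s).
Proof.
rewrite sorted_pairwise; last exact: ordlt_trans.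
elim: s => [|x s IHs] /=; first by move=> _; left.
move=> /andP[/allP xs /IHs {}IHs]; apply: (iffP andP).
  move=> [/allP rx /IHs rs] i j.
  rewrite !inE => /orP[/eqP->|si] /orP[/eqP->|sj] ij.
  - by rewrite ltnn in ij.
  - exact: rx.
  - by have := xs _ si; rewrite /ordlt; lia.
  - exact: rs.
move=> rs; split.
  by apply/allP => j sj; apply: rs; rewrite ?inE ?eqxx ?sj ?orbT //; exact: xs.
by apply/IHs => i j si sj; apply: rs; rewrite inE ?si ?sj orbT.
Qed.

Definition incr_on_colors n k (c : {ffun 'I_n -> 'I_k}) (f : {ffun 'I_n -> 'I_n}) :=
  [forall i : 'I_n, forall j : 'I_n, (i < j) && (c i == c j) ==> (f i < f j)].

Lemma incr_on_colorsP n k (c : {ffun 'I_n -> 'I_k}) (f : {ffun 'I_n -> 'I_n}) :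
  reflect (forall i j : 'I_n, i < j -> c i = c j -> f i < f j)
          (incr_on_colors c f).
Proof.
apply: (iffP forallP) => [H i j ij cij|H i].
  by move/forallP: (H i) => /(_ j); rewrite ij cij eqxx.
by apply/forallP => j; apply/implyP => /andP[ij /eqP cij]; exact: H.
Qed.

Definition color_class n k (c : {ffun 'I_n -> 'I_k}) (j : 'I_k) :=
  [set i | c i == j].

Lemma incr_color_classP n k (c : {ffun 'I_n -> 'I_k}) (f : {ffun 'I_n -> 'I_n}) :
  reflect (forall j, sorted (@ordlt n) [seq f i | i <- enum (color_class c j)])
          (incr_on_colors c f).
Proof.
apply: (iffP (incr_on_colorsP c f)) => H.
  move=> j; rewrite sorted_pairwise; last exact: ordlt_trans.
  rewrite pairwise_map; apply/pairwise_ordP; first exact: enum_set_sorted.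
  move=> i i'; rewrite !mem_enum !inE => /eqP ci /eqP ci' ii'.
  by apply: H; rewrite ?ci.
move=> i i' ii' cii'; move: (H (c i)).
rewrite sorted_pairwise; last exact: ordlt_trans.
rewrite pairwise_map => /(pairwise_ordP _ (enum_set_sorted _)) /(_ i i').
by rewrite !mem_enum !inE cii' eqxx; exact.
Qed.

Lemma sorted_enum_imset n (A : {set 'I_n}) (f : 'I_n -> 'I_n) :
  sorted (@ordlt n) [seq f i | i <- enum A] ->
  [seq f i | i <- enum A] = enum (f @: A).
Proof.
move=> sA; apply: (irr_sorted_eq (@ordlt_trans n)) => //.
- by move=> i; rewrite /ordlt ltnn.
- exact: enum_set_sorted.
move=> x; rewrite mem_enum; apply/mapP/imsetP => [] [i iA ->]; exists i => //;
  by rewrite mem_enum in iA *.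
Qed.

(** An increasing map on a class is determined by its image, and every set of the right size is an
    image. The images of distinct classes may overlap, so the choices are independent and the count
    is a product. *)
Lemma card_incr_on_colors n k (c : {ffun 'I_n -> 'I_k}) :
  #|[set f | incr_on_colors c f]| = \prod_j 'C(n, #|color_class c j|).
Proof.
pose Phi (f : {ffun 'I_n -> 'I_n}) := [ffun j => f @: color_class c j].
pose Fam (j : 'I_k) := [set S : {set 'I_n} | #|S| == #|color_class c j|].
have PhiI : {in [set f | incr_on_colors c f] &, injective Phi}.
  move=> f g; rewrite !inE => /incr_color_classP fi /incr_color_classP gi fg.
  apply/ffunP => i; have := congr1 (fun h : {ffun _} => h (c i)) fg.
  rewrite !ffunE => fgi.
  have := sorted_enum_imset (gi (c i)).
  rewrite -fgi -(sorted_enum_imset (fi (c i))) => /eq_in_map/(_ i).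
  by rewrite mem_enum inE eqxx => ->.
rewrite -(card_in_imset PhiI).
have -> : Phi @: [set f | incr_on_colors c f] = [set S | S \in family Fam].
  apply/setP => S; rewrite inE; apply/imsetP/familyP.
    move=> [f]; rewrite inE => /incr_color_classP fi -> j; rewrite ffunE inE.
    have := congr1 size (sorted_enum_imset (fi j)).
    by rewrite size_map -!cardE => ->.
  move=> SF.
  (* The inverse of [Phi]: the l-th position of class [j] receives the l-th element of [S j]. The
     default [i] is never reached, both lists having the same length. *)
  pose f : {ffun 'I_n -> 'I_n} := [ffun i =>
    nth i (enum (S (c i))) (index i (enum (color_class c (c i))))].
  have fE j : [seq f i | i <- enum (color_class c j)] = enum (S j).
    have szE : size (enum (color_class c j)) = size (enum (S j)).
      by have := SF j; rewrite inE -!cardE => /eqP.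
    case e : (enum (S j)) => [|x0 s0].
      by move: szE; rewrite e; case: (enum _).
    rewrite -e; apply: (@eq_from_nth _ x0); rewrite size_map // => l lS.
    have iC : nth x0 (enum (color_class c j)) l \in color_class c j.
      by rewrite -mem_enum mem_nth.
    rewrite (nth_map x0) // ffunE; move: (iC); rewrite inE => /eqP ->.
    rewrite index_uniq ?enum_uniq //; apply: set_nth_default; by rewrite -szE.
  exists f.
    by rewrite inE; apply/incr_color_classP => j; rewrite fE enum_set_sorted.
  apply/ffunP => j; rewrite ffunE; apply/setP => x.
  rewrite -mem_enum -fE; apply/mapP/imsetP => [] [i iA ->]; exists i => //;
    by rewrite mem_enum in iA *.
rewrite cardsE card_family foldrE big_image /=; apply: eq_bigr => j _.
by rewrite card_draws card_ord.
Qed.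

Definition colored_words n k :=
  [set p : {ffun 'I_n -> 'I_k} * {ffun 'I_n -> 'I_n} | incr_on_colors p.1 p.2].

Lemma card_colored_words n k :
  #|colored_words n k| =
  \sum_(c : {ffun 'I_n -> 'I_k}) \prod_j 'C(n, #|color_class c j|).
Proof.
under eq_bigr do rewrite -card_incr_on_colors -sum1_card.
rewrite pair_big_dep -sum1_card; apply: eq_bigl => p /=.
by rewrite !inE.
Qed.

Lemma sum_color_class n k (c : {ffun 'I_n -> 'I_k}) :
  \sum_j #|color_class c j| = n.
Proof.
under eq_bigr do rewrite -sum1_card.
transitivity (\sum_(i < n) 1); last by rewrite sum1_card card_ord.
rewrite (partition_big c xpredT) //=; apply: eq_bigr => j _.
by apply: eq_bigl => i; rewrite inE.
Qed.

(** * Upper bound for the number of coloured words *)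

Lemma leq_bin_expn a b n m : 'C(n, m) * (a ^ (n - m) * b ^ m) <= (a + b) ^ n.
Proof.
case: (leqP m n) => mn; last by rewrite bin_small.
rewrite expnDn (bigD1 (Ordinal (mn : m < n.+1))) //=; exact: leq_addr.
Qed.

(** With [k.+1] colours, [k ^ (k * n)] splits as a product of [k ^ (n - a)] over the class sizes
    [a], because these sum to [n]. Each colour then contributes at most [k.+1 ^ n], and there are
    [k.+1 ^ n] colourings. *)
Lemma colored_words_ub n k :
  #|colored_words n k.+1| * k ^ (k * n) <= k.+1 ^ (k.+2 * n).
Proof.
rewrite card_colored_words big_distrl /=.
have -> : k.+1 ^ (k.+2 * n) = \sum_(c : {ffun 'I_n -> 'I_k.+1}) k.+1 ^ (k.+1 * n).
  rewrite sum_nat_const card_ffun !card_ord -expnD; congr (_ ^ _); lia.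
apply: leq_sum => c _.
have -> : k ^ (k * n) = \prod_j k ^ (n - #|color_class c j|).
  rewrite -expn_sum sumnB; last first.
    by move=> j _; rewrite -[X in _ <= X]card_ord max_card.
  rewrite sum_color_class sum_nat_const card_ord; congr (_ ^ _); lia.
have -> : k.+1 ^ (k.+1 * n) = \prod_(j < k.+1) k.+1 ^ n.
  by rewrite prod_nat_const card_ord -expnM mulnC.
rewrite -big_split /=; apply: leq_prod => j _.
by have := leq_bin_expn k 1 n #|color_class c j|; rewrite exp1n muln1 addn1.
Qed.

(** * Lower bound for the number of coloured words *)

(** The terms [t a] of the expansion of [(k + 1) ^ N] rise up to [a = q] and fall afterwards, so
    each of the [N.+1] terms is at most [t q]. Comparing [t a] with [t a.+1] amounts to comparing
    [a.+1 * k] with [N - a]. *)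
Lemma central_bin_lb k q :
  k.+1 ^ (k.+1 * q) <= (k.+1 * q).+1 * ('C(k.+1 * q, q) * k ^ (k * q)).
Proof.
set N := k.+1 * q; pose t a := 'C(N, a) * k ^ (N - a).
have up a : a < q -> t a <= t a.+1.
  move=> aq; rewrite /t (_ : N - a = (N - a.+1).+1); last by rewrite /N; nia.
  rewrite expnS mulnA leq_mul2r; apply/orP; right.
  rewrite -(leq_pmul2l (ltn0Sn a)) mul_bin_left mulnCA [leqRHS]mulnC.
  by rewrite leq_mul2l; apply/orP; right; rewrite /N; nia.
have dn a : q <= a -> a < N -> t a.+1 <= t a.
  move=> qa aN; rewrite /t (_ : N - a = (N - a.+1).+1); last by lia.
  rewrite expnS mulnA leq_mul2r; apply/orP; right.
  rewrite -(leq_pmul2l (ltn0Sn a)) mul_bin_left [leqRHS]mulnCA mulnC.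
  by rewrite leq_mul2l; apply/orP; right; rewrite /N in aN *; nia.
have tq a : a <= N -> t a <= t q.
  case: (leqP a q) => [aq _|/ltnW].
    rewrite -(subKn aq); elim: (q - a) (leq_subr a q) => [|d IHd] dq.
      by rewrite subn0.
    apply: leq_trans (IHd (ltnW dq)).
    by rewrite (_ : q - d = (q - d.+1).+1) ?up //; lia.
  move=> qa; rewrite -(subnKC qa); elim: (a - q) => [|d IHd] dN.
    by rewrite addn0.
  apply: leq_trans (IHd _); last by lia.
  by rewrite addnS; apply: dn; lia.
have -> : k.+1 ^ N = (k + 1) ^ N by rewrite addn1.
rewrite expnDn.
apply: (@leq_trans (\sum_(i < N.+1) t q)).
  by apply: leq_sum => i _; rewrite exp1n muln1; apply: tq; rewrite -ltnS.
rewrite sum_nat_const card_ord /t /N (_ : k.+1 * q - q = k * q) //; lia.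
Qed.

(** Pigeonhole: the vector of class sizes takes at most [q.+1 ^ k] values. *)
Lemma frequent_content k q : exists a : {ffun 'I_k -> 'I_q.+1},
  k ^ q <= q.+1 ^ k *
    #|[set u : {ffun 'I_q -> 'I_k} | [forall j, #|color_class u j| == a j]]|.
Proof.
pose cont (u : {ffun 'I_q -> 'I_k}) : {ffun 'I_k -> 'I_q.+1} :=
  [ffun j => inord #|color_class u j|].
have contE u : [set v | [forall j, #|color_class v j| == cont u j]] =
               [set v | cont v == cont u].
  apply/setP => v; rewrite !inE.
  have cl (w : {ffun 'I_q -> 'I_k}) j : #|color_class w j| < q.+1.
    by rewrite ltnS -[X in _ <= X]card_ord max_card.
  apply/forallP/eqP => [vu|/ffunP vu j].
    by apply/ffunP => j; rewrite !ffunE (eqP (vu j)) ffunE inordK.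
  by move: (congr1 val (vu j)); rewrite !ffunE /= !inordK // => ->.
pose a := [arg max_(a > [ffun=> ord0]) #|[set v | cont v == a]|].
have aP b : #|[set v | cont v == b]| <= #|[set v | cont v == a]|.
  by rewrite /a; case: arg_maxnP => // c _; exact.
have cards : k ^ q = \sum_b #|[set v | cont v == b]|.
  rewrite -[k in k ^ _](card_ord k) -[q in _ ^ q](card_ord q) -card_ffun.
  rewrite -sum1_card (partition_big cont xpredT) //=; apply: eq_bigr => b _.
  by rewrite -sum1_card; apply: eq_bigl => v; rewrite inE.
have ub : k ^ q <= q.+1 ^ k * #|[set v | cont v == a]|.
  rewrite cards; apply: leq_trans (leq_sum _ (fun b _ => aP b)) _.
  by rewrite sum_nat_const card_ffun !card_ord.
(* An empty largest fibre forces [k ^ q = 0]; otherwise some [u] realises the content [a]. *)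
have [|/finset.set0Pn[u]] := eqVneq [set v | cont v == a] finset.set0.
  by move=> e; exists a; apply: leq_trans ub _; rewrite e cards0 muln0.
rewrite inE => /eqP ua; exists a.
by move: ub; rewrite -ua contE.
Qed.

(* Placing the k cyclic shifts of words with a common content side by side
   produces a balanced word. *)
Lemma balanced_colorings_lb k q :
  k.+1 ^ (k.+1 * q) <= q.+1 ^ (k.+1 * k.+1) *
    #|[set c : {ffun 'I_(k.+1 * q) -> 'I_k.+1} |
        [forall j, #|color_class c j| == q]]|.
Proof.
have [a aP] := frequent_content k.+1 q.
set U := [set u | _] in aP.
(* Any bijection serves, since class sizes do not depend on the order of the positions. *)
have [h hbij] : exists h : 'I_(k.+1 * q) -> 'I_k.+1 * 'I_q, bijective h.
  have e : #|{: 'I_k.+1 * 'I_q}| = k.+1 * q by rewrite card_prod !card_ord.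
  exists (fun i => enum_val (cast_ord (esym e) i)).
  by apply: bij_comp (enum_val_bij _) _; exists (cast_ord e);
    [exact: cast_ordKV|exact: cast_ordK].
(* Colours are added modulo [k.+1]: block [s] is shifted by [s], so colour [j] occurs [a (j - s)]
   times in it. Summed over [s], this is the total of [a], which is [q] for every [j]. *)
pose F (u : {ffun 'I_k.+1 -> {ffun 'I_q -> 'I_k.+1}}) :
    {ffun 'I_(k.+1 * q) -> 'I_k.+1} := [ffun i => u (h i).1 (h i).2 + (h i).1]%R.
have Finj : injective F.
  move=> u v /ffunP uv; apply/ffunP => s; apply/ffunP => x.
  case: hbij => h' hK h'K; have := uv (h' (s, x)).
  by rewrite !ffunE h'K /= => /addIr.
have Fbal u : u \in ffun_on U -> F u \in [set c | [forall j, #|color_class c j| == q]].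
  move=> /ffun_onP uU; rewrite inE; apply/forallP => j; apply/eqP.
  have -> : color_class (F u) j = h @^-1: [set x | u x.1 x.2 + x.1 == j]%R.
    by apply/setP => i; rewrite !inE ffunE.
  rewrite on_card_preimset; last exact: onW_bij.
  rewrite -sum1_card (eq_bigl (fun x => u x.1 x.2 == j - x.1)%R); last first.
    by move=> x; rewrite inE eq_sym -subr_eq eq_sym.
  rewrite -(pair_big_dep xpredT (fun s x => u s x == j - s)%R (fun _ _ => 1%N)) /=.
  rewrite (eq_bigr (fun s => a (j - s)%R : nat)); last first.
    move=> s _; have := uU s; rewrite inE => /forallP /(_ (j - s)%R) /eqP <-.
    by rewrite sum1_card; apply: eq_card => x; rewrite inE.
  rewrite (reindex_inj (subrI j)) /=.
  under eq_bigr do rewrite subKr.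
  have : 0 < #|U|.
    by move: aP; case: (#|U|) => //; rewrite muln0 leqn0 expn_eq0.
  move/card_gt0P => [w]; rewrite inE => /forallP wU.
  rewrite -[RHS](sum_color_class w); apply: eq_bigr => s _.
  by rewrite (eqP (wU s)).
have : #|@ffun_on 'I_k.+1 U| <= #|[set c : {ffun 'I_(k.+1 * q) -> 'I_k.+1} |
        [forall j, #|color_class c j| == q]]|.
  rewrite -(card_imset (ffun_on U) Finj); apply/subset_leq_card/fintype.subsetP.
  by move=> c /imsetP[u uU ->]; exact: Fbal.
rewrite card_ffun_on card_ord => le; apply: leq_trans (leq_mul (leqnn _) le).
by rewrite mulnC expnM expnM -expnMn leq_exp2r.
Qed.

(** Each balanced colouring carries ['C(n, q) ^ k.+1] words. The bound on the number of balanced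
    colourings is multiplied by [k.+1] copies of the binomial bound; the polynomial exponents add up
    to [k.+1 * k.+1 + k.+1]. *)
Lemma colored_words_lb k q (n := k.+1 * q) :
  k.+1 ^ (k.+2 * n) <=
  n.+1 ^ (k.+1 * k.+2) * (#|colored_words n k.+1| * k ^ (k * n)).
Proof.
set M := #|[set c : {ffun 'I_n -> 'I_k.+1} | [forall j, #|color_class c j| == q]]|.
have lbA : M * 'C(n, q) ^ k.+1 <= #|colored_words n k.+1|.
  rewrite card_colored_words -sum_nat_const big_mkcond /=.
  apply: leq_sum => c _; case: ifP => //; rewrite inE => /forallP cP.
  rewrite (eq_bigr (fun=> 'C(n, q))); last by move=> j _; rewrite (eqP (cP j)).
  by rewrite prod_nat_const card_ord.
have lbM : k.+1 ^ n <= n.+1 ^ (k.+1 * k.+1) * M.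
  apply: leq_trans (balanced_colorings_lb k q) _; rewrite leq_mul2r.
  by rewrite leq_exp2r // ltnS leq_pmull ?orbT.
have lbC : (k.+1 ^ n) ^ k.+1 <= (n.+1 * ('C(n, q) * k ^ (k * q))) ^ k.+1.
  by rewrite leq_exp2r ?central_bin_lb.
have := leq_mul lbM lbC.
rewrite -expnM -expnD (_ : n + n * k.+1 = k.+2 * n); last by lia.
move/leq_trans; apply.
rewrite !expnMn -expnM (_ : k * q * k.+1 = k * n); last by rewrite /n; lia.
apply: (@leq_trans (n.+1 ^ (k.+1 * k.+2) * (M * 'C(n, q) ^ k.+1 * k ^ (k * n)))).
  rewrite (_ : k.+1 * k.+2 = k.+1 * k.+1 + k.+1); last by lia.
  by rewrite expnD; apply: eq_leq; lia.
by rewrite leq_mul2l leq_mul2r lbA !orbT.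
Qed.

(** * Weakly increasing subsequences and colourings *)

(** Subsequences are handled as sets of positions instead of masks. *)
Definition weak_chain n (w : n.-tuple 'I_n) (S : {set 'I_n}) :=
  [forall i in S, forall j in S, (i < j) ==> (tnth w i <= tnth w j)].

Lemma weak_chainP n (w : n.-tuple 'I_n) (S : {set 'I_n}) :
  reflect {in S &, forall i j : 'I_n, i < j -> tnth w i <= tnth w j}
          (weak_chain w S).
Proof.
apply: (iffP forall_inP) => H.
  by move=> i j iS jS; move/forall_inP: (H i iS) => /(_ j jS)/implyP.
by move=> i iS; apply/forall_inP => j jS; apply/implyP; exact: H.
Qed.

Lemma mask_enum_set n (msk : n.-tuple bool) (w : n.-tuple 'I_n) :
  mask msk w = [seq tnth w i | i <- enum [set i | tnth msk i]].
Proof.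
rewrite -{1}(map_tnth_enum w) -map_mask; congr map.
rewrite -{1}(map_tnth_enum msk) -filter_mask enumT /enum_mem.
by apply: eq_filter => i; rewrite -[RHS]/(i \in [set j | tnth msk j]) inE.
Qed.

Lemma weak_incr_subseqP n m (w : n.-tuple 'I_n) :
  reflect (exists2 S : {set 'I_n}, #|S| = m & weak_chain w S)
          (has_weak_incr_subseq m w).
Proof.
have sortE (S : {set 'I_n}) :
    sorted (fun a b : 'I_n => a <= b) [seq tnth w i | i <- enum S] = weak_chain w S.
  rewrite sorted_pairwise; last by move=> x y z; exact: leq_trans.
  rewrite pairwise_map.
  apply/(pairwise_ordP _ (enum_set_sorted _))/weak_chainP => H i j iS jS;
    by apply: H; rewrite ?mem_enum // -mem_enum.
have countE (msk : n.-tuple bool) : count id msk = #|[set i | tnth msk i]|.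
  by rewrite cardE -(size_map (tnth w)) -mask_enum_set size_mask // !size_tuple.
apply: (iffP existsP) => [[msk /andP[/eqP cm sm]]|[S cS chS]].
  by exists [set i | tnth msk i]; rewrite -?countE // -sortE -mask_enum_set.
exists [tuple i \in S | i < n]; rewrite countE mask_enum_set sortE.
have -> : [set i | tnth [tuple i0 \in S | i0 < n] i] = S.
  by apply/setP => i; rewrite inE tnth_mktuple.
by rewrite cS eqxx.
Qed.

Definition k_increasing_words n k :=
  [set f | [exists c : {ffun 'I_n -> 'I_k}, incr_on_colors c f]].

(* A position is coloured by the length of the longest weakly increasing
   subsequence ending there. *)
Lemma decr_coloring n k (w : n.-tuple 'I_n) :
  ~~ has_weak_incr_subseq k.+1 w ->
  exists c : {ffun 'I_n -> 'I_k},
    forall i j : 'I_n, i < j -> c i = c j -> tnth w j < tnth w i.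
Proof.
move=> Hw.
pose ends (i : 'I_n) (S : {set 'I_n}) :=
  [&& i \in S, [forall j in S, j <= i] & weak_chain w S].
pose h i := \max_(S | ends i S) #|S|.
have h1 i : 0 < h i.
  rewrite -(cards1 i); apply: (leq_bigmax_cond [set i]).
  rewrite /ends set11 /=; apply/andP; split.
    by apply/forall_inP => j; rewrite inE => /eqP ->.
  by apply/weak_chainP => x y; rewrite !inE => /eqP -> /eqP ->; rewrite ltnn.
have subch (S T : {set 'I_n}) : T \subset S -> weak_chain w S -> weak_chain w T.
  move=> /fintype.subsetP TS /weak_chainP Sch.
  by apply/weak_chainP => x y xT yT; apply: Sch; exact: TS.
have small (S : {set 'I_n}) : weak_chain w S -> #|S| <= k.
  move=> Sch; rewrite leqNgt; apply/negP => kS; case/negP: Hw.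
  apply/weak_incr_subseqP.
  have /card_geqP[s [us ss sS]] := kS.
  exists [set x in s]; first by rewrite cardsE (card_uniqP us).
  by apply: subch Sch; apply/fintype.subsetP => x; rewrite inE; exact: sS.
(* Lengths range over 1, ..., [k]; the predecessor makes them colours in ['I_k]. *)
have hk i : (h i).-1 < k.
  by rewrite prednK //; apply/bigmax_leqP => S /and3P[_ _]; exact: small.
exists [ffun i => Ordinal (hk i)] => i j ij; rewrite !ffunE => -[hij].
rewrite ltnNge; apply/negP => wij.
(* If the letter at [i] is at most the one at [j], a longest chain [S] ending at [i] extends by [j],
   contradicting equal colours. *)
suff : h i < h j by have := h1 i; have := h1 j; lia.
have [|S eS hS] := @eq_bigmax_cond _ (ends i) (fun S => #|S|).
  rewrite lt0n; apply: contraTneq (h1 i) => /card0_eq e.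
  by rewrite -leqNgt /h big_pred0.
rewrite {1}/h hS.
case/and3P: eS => iS /forall_inP Si /weak_chainP Sch.
have jS : j \notin S by apply/negP => /Si; lia.
rewrite -(_ : #|j |: S| = #|S|.+1); last by rewrite cardsU1 jS.
apply: (leq_bigmax_cond (j |: S)); rewrite /ends !inE eqxx /=; apply/andP; split.
  by apply/forall_inP => x; rewrite !inE => /orP[/eqP->//|/Si]; lia.
apply/weak_chainP => x y; rewrite !inE => /orP[/eqP->|xS] /orP[/eqP->|yS].
- by rewrite ltnn.
- by have := Si _ yS; lia.
- move=> _; have [->//|xi] := eqVneq x i.
  apply: leq_trans wij; apply: Sch => //.
  by have := Si _ xS; rewrite leq_eqVlt => /orP[/eqP/val_inj/eqP|//]; rewrite (negbTE xi).
- exact: Sch.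
Qed.

(** Pigeonhole: among [k.+1] positions two share a colour, and there the word strictly decreases. *)
Lemma coloring_weak_subseq n k (w : n.-tuple 'I_n) (c : {ffun 'I_n -> 'I_k}) :
  (forall i j : 'I_n, i < j -> c i = c j -> tnth w j < tnth w i) ->
  ~~ has_weak_incr_subseq k.+1 w.
Proof.
move=> cP; apply/weak_incr_subseqP => -[S cS /weak_chainP Sch].
have /dinjectivePn[i iS [j]] : ~~ dinjectiveb c S.
  apply: contraTN (ltnSn k) => /dinjectiveP cinj.
  by rewrite -leqNgt -cS -[X in _ <= X]card_ord (leq_card_in _ _ cinj).
wlog ij : i j iS / i < j => [H|].
  rewrite !inE => /andP[ji jS] cij; have := ji; rewrite neq_ltn => /orP[] lt.
    by apply: (H j i) => //; rewrite !inE eq_sym ji iS.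
  by apply: (H i j) => //; rewrite !inE ji jS.
rewrite !inE => /andP[_ jS] cij.
by have := Sch _ _ iS jS ij; rewrite leqNgt cP.
Qed.

Lemma wbarE n k : wbar n k = #|k_increasing_words n k|.
Proof.
pose g (w : n.-tuple 'I_n) : {ffun 'I_n -> 'I_n} := [ffun i => rev_ord (tnth w i)].
have ginj : injective g.
  move=> u v /ffunP uv; apply: eq_from_tnth => i.
  by have := uv i; rewrite !ffunE => /rev_ord_inj.
rewrite /wbar -(card_imset _ ginj); apply: eq_card => f.
have gE w (i j : 'I_n) : (g w i < g w j) = (tnth w j < tnth w i).
  by rewrite !ffunE /=; have := ltn_ord (tnth w i); have := ltn_ord (tnth w j); lia.
apply/imsetP/idP => [[w]|].
  rewrite inE => /decr_coloring[c cP] ->; rewrite inE; apply/existsP; exists c.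
  by apply/incr_on_colorsP => i j ij cij; rewrite gE cP.
rewrite inE => /existsP[c /incr_on_colorsP cP].
pose w := [tuple rev_ord (f i) | i < n].
have gw : g w = f by apply/ffunP => i; rewrite ffunE tnth_mktuple rev_ordK.
exists w => //; rewrite inE; apply: (coloring_weak_subseq (c := c)) => i j ij cij.
by rewrite -gE gw cP.
Qed.

Lemma wbar_le_colored n k : wbar n k <= #|colored_words n k|.
Proof.
rewrite wbarE; apply: leq_trans (leq_imset_card snd _).
apply/subset_leq_card/fintype.subsetP => f; rewrite inE => /existsP[c cP].
by apply/imsetP; exists (c, f); rewrite ?inE.
Qed.

(** * Gluing coloured words of a fixed length into one long word *)

(** Position blocks are 0, ..., [N] and colours 0, ..., [k], so the letter blocks used are 0, ...,
    [N + k]; the hypothesis says that they fit. *)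
Lemma block_wbar L N n k : 
  (N.+1 + k) * L.+1 <= n.+1 ->
  #|colored_words L.+1 k.+1| ^ N.+1 <= wbar n.+1 k.+1.
Proof.
move=> Hn; set A := colored_words _ _.
pose b (p : nat) : 'I_N.+1 := inord (p %/ L.+1).
pose r (p : nat) : 'I_L.+1 := inord (p %% L.+1).
pose T : Type := ({ffun 'I_L.+1 -> 'I_k.+1} * {ffun 'I_L.+1 -> 'I_L.+1})%type.
(* Positions beyond the last block are fixed points, and [col] gives them colour 0. *)
pose v (P : {ffun 'I_N.+1 -> T}) (p : nat) : nat :=
  if p < N.+1 * L.+1 then (b p + (P (b p)).1 (r p)) * L.+1 + (P (b p)).2 (r p) else p.
pose col (P : {ffun 'I_N.+1 -> T}) : {ffun 'I_n.+1 -> 'I_k.+1} :=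
  [ffun p : 'I_n.+1 => if p < N.+1 * L.+1 then (P (b p)).1 (r p) else ord0].
pose F (P : {ffun 'I_N.+1 -> T}) : {ffun 'I_n.+1 -> 'I_n.+1} :=
  [ffun p : 'I_n.+1 => inord (v P p)].
have bE p : p < N.+1 * L.+1 -> b p = p %/ L.+1 :> nat.
  by move=> pN; rewrite inordK // ltn_divLR.
have rE p : r p = p %% L.+1 :> nat by rewrite inordK // ltn_mod.
have FE P (p : 'I_n.+1) : F P p = v P p :> nat.
  rewrite ffunE inordK // /v; case: ifP => // _.
  have := ltn_ord (b p); have := ltn_ord ((P (b p)).1 (r p)).
  have := ltn_ord ((P (b p)).2 (r p)); move: (nat_of_ord _) => x.
  move: (nat_of_ord _) => y; move: (nat_of_ord _) => z; nia.
have Finj : injective F.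
  move=> P Q /ffunP PQ; apply/ffunP => s.
  suff E i : (P s).1 i = (Q s).1 i /\ (P s).2 i = (Q s).2 i.
    rewrite (surjective_pairing (P s)) (surjective_pairing (Q s)).
    by congr pair; apply/ffunP => i; have [] := E i.
  have pN : s * L.+1 + i < N.+1 * L.+1 by have := ltn_ord s; have := ltn_ord i; nia.
  have pn : s * L.+1 + i < n.+1 by apply: leq_trans pN _; nia.
  have := congr1 (@nat_of_ord _) (PQ (Ordinal pn)); rewrite !FE /v /= pN.
  have -> : b (s * L.+1 + i) = s.
    by apply: val_inj; rewrite /= bE // divnMDl // divn_small ?addn0.
  have -> : r (s * L.+1 + i) = i.
    by apply: val_inj; rewrite /= rE modnMDl modn_small.
  (* The quotient by [L.+1] is block plus colour, and the block is known, so it yields the colour;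
     the remainder yields the local letter. *)
  move=> e; have := congr1 (modn^~ L.+1) e; have := congr1 (divn^~ L.+1) e.
  rewrite !divnMDl // !modnMDl !(divn_small, modn_small) // !addn0.
  by move=> /addnI/val_inj ? /val_inj ?.
have Fk P : P \in ffun_on A -> F P \in k_increasing_words n.+1 k.+1.
  move=> /ffun_onP PA; rewrite inE; apply/existsP; exists (col P).
  apply/incr_on_colorsP => p q pq; rewrite !FE !ffunE /v.
  case: (ltnP q) => qN; last first.
    (* Here [q] is a fixed point of colour 0. If [p] lies in a block, its colour is 0 too, so its
       letter stays in letter block [b p], below [N.+1 * L.+1 <= q]. *)
    case: ifP => // pN c0; rewrite c0 addn0.
    have := ltn_ord (b p); have := ltn_ord ((P (b p)).2 (r p)).
    by move: (nat_of_ord _) => x; move: (nat_of_ord _) => y; nia.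
  rewrite (ltn_trans pq qN) => cpq.
  have pN := ltn_trans pq qN.
  have : b p <= b q by rewrite !bE // leq_div2r // ltnW.
  rewrite leq_eqVlt => /orP[/eqP/val_inj bpq|bpq].
    rewrite -cpq bpq ltn_add2l.
    have := PA (b q); rewrite inE => /incr_on_colorsP; apply; last by rewrite -{1}bpq.
    rewrite !rE; move: pq; rewrite {1}(divn_eq p L.+1) {1}(divn_eq q L.+1).
    by rewrite -!bE // bpq ltn_add2l.
  (* A later position block with the same colour goes to a later letter block. *)
  rewrite -cpq.
  have fL := ltn_ord ((P (b p)).2 (r p)).
  apply: (@leq_trans ((b p + (P (b p)).1 (r p)).+1 * L.+1)).
    by rewrite mulSnr ltn_add2l.
  by apply: leq_trans (leq_addr _ _); rewrite leq_mul2r /= -addSn leq_add2r.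
have -> : #|A| ^ N.+1 = #|@ffun_on 'I_N.+1 A| by rewrite card_ffun_on card_ord.
rewrite wbarE -(card_imset _ Finj).
by apply/subset_leq_card/fintype.subsetP => f /imsetP[P PA ->]; exact: Fk.
Qed.

(** * Growth rate and passage to the limit *)

Local Open Scope classical_set_scope.
Local Open Scope ring_scope.

Lemma exp_dominates_poly (R : realType) (r C : R) (d : nat) : 1 < r ->
  exists n0 : nat, forall n : nat, (n0 <= n)%N -> C * n.+1%:R ^+ d <= r ^+ n.
Proof.
move=> r1; have s0 : 0 < ln r by exact: ln_gt0.
(* For [n >= K] the term of degree [d.+1] of the series of [expR (n%:R * ln r)] is at least
   [|C| (2n)^d]; this suffices because [n + 1 <= 2n] for [n >= 1]. *)
pose K := `|C| * 2 ^+ d * d.+1`!%:R / ln r ^+ d.+1.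
exists (Num.bound K).+1 => n hn.
have K0 : 0 <= K.
  by rewrite /K !mulr_ge0 ?invr_ge0 ?exprn_ge0 // ltW.
have Kn : K <= n%:R.
  by rewrite ltW // (lt_le_trans (archi_boundP K0)) // ler_nat ltnW.
have -> : r ^+ n = expR (n%:R * ln r) by rewrite expRM_natl lnK // posrE; lra.
have nr0 : 0 <= n%:R * ln r by rewrite mulr_ge0 // ltW.
apply: (@le_trans _ _ ((n%:R * ln r) ^+ d.+1 / d.+1`!%:R)); last first.
  by apply: le_trans (expR_ge1Dxn d nr0); rewrite lerDr.
rewrite ler_pdivlMr ?ltr0n ?fact_gt0 // exprMn.
have n1 : (1 <= n)%N by apply: leq_trans hn.
apply: (@le_trans _ _ (`|C| * (2 * n%:R) ^+ d * d.+1`!%:R)).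
  apply: ler_wpM2r => //; apply: le_trans (ler_wpM2r _ (ler_norm C)) _ => //.
  rewrite ler_wpM2l // lerXn2r ?nnegrE // -natrM ler_nat; lia.
have -> : `|C| * (2 * n%:R) ^+ d * d.+1`!%:R = K * n%:R ^+ d * ln r ^+ d.+1.
  by rewrite /K exprMn; field; rewrite expf_neq0 // gt_eqF.
by rewrite [n%:R ^+ d.+1]exprS !ler_wpM2r ?exprn_ge0 // ltW.
Qed.

(** The claimed limit for [k.+1] colours, shifted to avoid predecessors; at [k = 0] the denominator
    is [0 ^+ 0 = 1]. *)
Definition growth_rate (R : realType) (k : nat) : R := k.+1%:R ^+ k.+2 / k%:R ^+ k.

Lemma growth_den_gt0 (R : realType) (k : nat) : 0 < k%:R ^+ k :> R.
Proof. by case: k => [|k]; rewrite ?expr0 // exprn_gt0. Qed.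

Lemma growth_rate_gt0 (R : realType) (k : nat) : 0 < growth_rate R k.
Proof. by rewrite divr_gt0 ?growth_den_gt0 // exprn_gt0. Qed.

Lemma wbar_ub (R : realType) (n k : nat) :
  (wbar n k.+1)%:R <= growth_rate R k ^+ n.
Proof.
rewrite expr_div_n ler_pdivlMr ?(exprn_gt0 _ (growth_den_gt0 _ _)) // -!exprM.
rewrite -!natrX -natrM ler_nat.
apply: leq_trans (colored_words_ub n k).
by rewrite leq_mul2r wbar_le_colored orbT.
Qed.

Lemma colored_words_real_lb (R : realType) (k q : nat) (n := (k.+1 * q)%N) :
  growth_rate R k ^+ n <= n.+1%:R ^+ (k.+1 * k.+2) * #|colored_words n k.+1|%:R.
Proof.
rewrite expr_div_n ler_pdivrMr ?(exprn_gt0 _ (growth_den_gt0 _ _)) // -!exprM.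
by rewrite -!natrX -!natrM ler_nat -mulnA; exact: colored_words_lb.
Qed.

(** With [z] strictly between [y] and the growth rate, the gap above [z] absorbs the polynomial loss
    at one fixed block length, and the gap below [z] absorbs the positions left uncovered by
    blocks. *)
Lemma wbar_lb (R : realType) (k : nat) (y : R) : 0 < y < growth_rate R k ->
  exists n0 : nat, forall n, (n0 <= n)%N -> y ^+ n.+1 <= (wbar n.+1 k.+1)%:R.
Proof.
move=> /andP[y0 yB]; set B := growth_rate R k in yB.
pose z := (y + B) / 2; have zy : y < z by rewrite /z; lra.
have zB : z < B by rewrite /z; lra.
have z0 : 0 < z := lt_trans y0 zy.
have [q0 hq0] := @exp_dominates_poly R (B / z) 1 (k.+1 * k.+2)%N
  ltac:(by rewrite ltr_pdivlMr // mul1r).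
have [L hL] : exists L : nat, z ^+ L.+1 <= #|colored_words L.+1 k.+1|%:R.
  (* A block length divisible by [k.+1], as balanced colourings require. *)
  exists (k.+1 * q0.+1).-1; rewrite prednK //.
  have := hq0 (k.+1 * q0.+1)%N ltac:(nia).
  have := colored_words_real_lb R k q0.+1.
  rewrite mul1r expr_div_n ler_pdivlMr ?exprn_gt0 //.
  move=> h1 h2; have := le_trans h2 h1.
  by rewrite ler_pM2l ?exprn_gt0.
(* At most [k.+1 * L.+1] positions stay uncovered; the maximum with 1 keeps powers monotone when
   [z < 1]. *)
pose C := Num.max 1 z ^+ (k.+1 * L.+1).
have [n1 hn1] := @exp_dominates_poly R (z / y) C 0
  ltac:(by rewrite ltr_pdivlMr // mul1r).
exists (n1 + k.+2 * L.+1)%N => n hn.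
pose N := (n.+1 %/ L.+1 - k.+1)%N.
have NE : (n.+1 %/ L.+1 = N.+1 + k)%N.
  have : (k.+2 <= n.+1 %/ L.+1)%N by rewrite leq_divRL //; nia.
  by rewrite /N; lia.
have Nn : ((N.+1 + k) * L.+1 <= n.+1)%N by rewrite -NE leq_trunc_div.
have nN : (n.+1 < (N.+1 + k).+1 * L.+1)%N by rewrite -NE ltn_ceil.
apply: le_trans (_ : (z ^+ L.+1) ^+ N.+1 <= _); last first.
  apply: (@le_trans _ _ (#|colored_words L.+1 k.+1|%:R ^+ N.+1)).
    by rewrite lerXn2r ?nnegrE ?exprn_ge0 // ltW.
  by rewrite -natrX ler_nat block_wbar.
have C0 : 0 < C by rewrite exprn_gt0 // lt_max ltr01.
(* The chain is [C * y ^+ n.+1 <= z ^+ n.+1 <= z ^+ (L.+1 * N.+1) * C]. *)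
rewrite -(ler_pM2r C0) -exprM.
have := hn1 n.+1 ltac:(nia).
rewrite expr0 mulr1 expr_div_n ler_pdivlMr ?exprn_gt0 // mulrC => /le_trans; apply.
rewrite -(@subnKC (L.+1 * N.+1) n.+1); last by nia.
rewrite exprD ler_pM2l ?exprn_gt0 //.
apply: (@le_trans _ _ (Num.max 1 z ^+ (n.+1 - L.+1 * N.+1))).
  by rewrite lerXn2r ?nnegrE ?le_max ?lexx ?orbT ?ler01 // ltW.
by apply: ler_weXn2l; [rewrite le_max lexx|nia].
Qed.

Lemma powR_expr_inv (R : realType) (x : R) (n : nat) : 0 <= x ->
  (x ^+ n.+1) `^ (n.+1%:R)^-1 = x.
Proof.
by move=> x0; rewrite -powR_mulrn // -powRrM mulfV ?pnatr_eq0 // powRr1.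
Qed.

Theorem theorem3p9 (R : realType) (k : nat) (hk : (0 < k)%N) :
  (fun n : nat => ((wbar n.+1 k)%:R : R) `^ (n.+1%:R)^-1) @ \oo -->
    (k%:R ^+ k.+1 / (k.-1)%:R ^+ k.-1 : R).
Proof.
case: k hk => // k _; rewrite -[X in _ --> X]/(growth_rate R k).
have root_le n : {in Num.nneg &, {homo (@powR R)^~ (n.+1%:R^-1) : x y / x <= y}}.
  by apply: ge0_ler_powR; rewrite invr_ge0.
have B0 := growth_rate_gt0 R k.
apply/cvgrPdist_le => e e0.
(* Within [e] of the limit, yet positive even for large [e]. *)
pose y := Num.max (growth_rate R k - e) (growth_rate R k / 2).
have yP : 0 < y < growth_rate R k.
  by rewrite lt_max gt_max; apply/andP; split; [apply/orP; right|apply/andP; split]; lra.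
have y0 : 0 < y by case/andP: yP.
have [n0 hn0] := wbar_lb yP.
exists n0 => // n /= n0n.
have ub : (wbar n.+1 k.+1)%:R `^ n.+1%:R^-1 <= growth_rate R k.
  rewrite -[leRHS](@powR_expr_inv _ _ n) ?(ltW B0) //.
  by apply: root_le; rewrite ?nnegrE ?exprn_ge0 ?wbar_ub // ltW.
have lb : y <= (wbar n.+1 k.+1)%:R `^ n.+1%:R^-1.
  rewrite -[leLHS](@powR_expr_inv _ _ n) ?(ltW y0) //.
  by apply: root_le; rewrite ?nnegrE ?exprn_ge0 ?hn0 // ltW.
rewrite ger0_norm ?subr_ge0 // lerBlDr -lerBlDl.
by apply: le_trans lb; rewrite le_max lexx.
Qed.
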